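(* Let $i\ge 1$ and let $d_1,\dots,d_i>1$ be integers. The number of stagings $\mathbf{s}_i$ of level $i$, i.e. of $\mathcal{X}_{[i]}=\prod_{k=1}^i[d_k]$, in which each stage has at most two context variables (that is, $|S|\le 2$ for every stage $\mathcal{S}(\mathbf{x}_S)\in\mathbf{s}_i$) is $$1-\binom{i}{2}+\sum_{k=1}^{i} i^{d_k}.$$
   Context: Write $[n]=\{1,\dots,n\}$. For $k\in[i]$ let $\mathcal{X}_k=[d_k]$ with $d_k>1$ an integer, and for $S\subseteq[i]$ let $\mathcal{X}_S=\prod_{k\in S}\mathcal{X}_k$. The set $\mathcal{X}_{[i]}$ is called level $i$. For $S\subseteq[i]$ and $\mathbf{x}_S\in\mathcal{X}_S$, the stage with stage-defining context $\mathbf{x}_S$ and set of context variables $S$ is $$\mathcal{S}(\mathbf{x}_S)=\{\mathbf{y}\in\mathcal{X}_{[i]} : \mathbf{y}_S=\mathbf{x}_S\},$$ where $\mathbf{y}_S$ is the restriction of $\mathbf{y}$ to the coordinates in $S$. For $S=\emptyset$ this is all of $\mathcal{X}_{[i]}$. Since all $d_k>1$, a stage, as a set, determines $S$ and $\mathbf{x}_S$. A (CStree) staging of level $i$ is a partition $\mathbf{s}_i$ of $\mathcal{X}_{[i]}$ all of whose blocks are stages. Stagings are counted as set partitions. *)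

(* Defs.v *)
From mathcomp Require Import all_boot all_order all_algebra.

Set Implicit Arguments.
Unset Strict Implicit.
Unset Printing Implicit Defensive.

Section CStreeStagings.
Variables (i : nat) (d : 'I_i -> nat).

Definition level : finType := {dffun forall k : 'I_i, 'I_(d k)}.

Definition context (S : {set 'I_i}) : finType :=
  {dffun forall k : {k : 'I_i | k \in S}, 'I_(d (val k))}.

Definition restr (S : {set 'I_i}) (y : level) : context S :=
  [ffun k : {k : 'I_i | k \in S} => y (val k)].

Definition stage (S : {set 'I_i}) (xS : context S) : {set level} :=
  [set y : level | restr S y == xS].

Definition is_stage (B : {set level}) : bool :=
  [exists S : {set 'I_i}, [exists xS : context S, B == stage xS]].

Definition staging (P : {set {set level}}) : bool :=
  partition P [set: level] && [forall B in P, is_stage B].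

(* The quantification over all presentations [stage xS] of a block is harmless:
   when every [d k > 1], a stage determines its set [S] of context variables. *)
Definition max_context_vars (m : nat) (P : {set {set level}}) : bool :=
  [forall S : {set 'I_i}, [forall xS : context S,
    (stage xS \in P) ==> (#|S| <= m)]].

End CStreeStagings.

(* Main.v *)
Require Import Defs.
From mathcomp Require Import all_boot all_order all_algebra.

Set Implicit Arguments.
Unset Strict Implicit.
Unset Printing Implicit Defensive.

Import GRing.Theory.
Local Open Scope ring_scope.

(* A staging is encoded by the map [s] sending a point [y] to the set of context
   variables of its block; such maps are those for which [s z = s y] whenever
   [z] agrees with [y] on [s y].  Two blocks with different context sets must
   disagree at a common context variable, so when all context sets have size at
   most 2 the nonempty ones share a variable [k]: a "triangle" {a, b}, {b, c},
   {a, c} would leave a point uncovered.  The staging is then given by choosing,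
   for each value of the coordinate [k], one further variable ([k] itself when
   the slice is a single block), which makes i ^ d_k choices.  Summing over [k]
   counts every nontrivial staging once, except the C(i, 2) stagings whose
   context set is a constant pair, which are counted twice. *)

(** The case [j = k] covers singletons, so once [k] is fixed such a set is parametrised by a single
    element. *)
Lemma set_le2P (T : finType) (A : {set T}) (k : T) :
  k \in A -> (#|A| <= 2)%N -> exists j, A = [set k; j].
Proof.
move=> kA; rewrite (cardsD1 k) kA ltnS leq_eqVlt => /orP[/cards1P[j Ej]|].
  by exists j; rewrite -(setD1K kA) Ej.
rewrite ltnS leqn0 cards_eq0 => /eqP E0.
by exists k; rewrite -(setD1K kA) E0 setU0 setUid.
Qed.

Lemma set2_injr (T : finType) (k : T) : injective (fun j => [set k; j]).
Proof.
move=> a b /setP E; move: (E a) (E b); rewrite !inE !eqxx !orbT.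
by move=> /esym/orP[/eqP ->|/eqP //] /orP[/eqP ->|/eqP //].
Qed.

Section ContextMaps.
Variables (i : nat) (d : 'I_i -> nat).
Hypothesis d_gt1 : forall k : 'I_i, (1 < d k)%N.

Implicit Types (y z w : level d) (T : {set 'I_i}) (k : 'I_i).
Implicit Type s : {ffun level d -> {set 'I_i}}.

(** * Points of the level, and stages described through a point *)

Definition glue T y z : level d :=
  [ffun k : 'I_i => if k \in T then y k else z k].

Definition update y k (a : 'I_(d k)) : level d := finfun (dfwith y a).

Definition agree T y z := [forall k in T, z k == y k].

(** Indexing stages by a point they contain avoids handling the dependent type [context T]. *)
Definition cell T y : {set level d} := stage (restr T y).

Lemma agreeP T y z : reflect {in T, forall k, z k = y k} (agree T y z).
Proof. exact: 'forall_in_eqP. Qed.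

Lemma update_id y k (a : 'I_(d k)) : update y a k = a.
Proof. by rewrite ffunE dfwith_in. Qed.

Lemma update_neq y k (a : 'I_(d k)) j : k != j -> update y a j = y j.
Proof. by move=> kj; rewrite ffunE dfwith_out. Qed.

Lemma in_cell T y z : (z \in cell T y) = agree T y z.
Proof.
rewrite inE; apply/eqP/agreeP => [/ffunP E k kT|E].
  by move: (E (Sub k kT)); rewrite !ffunE.
by apply/ffunP => k; rewrite !ffunE E // (valP k).
Qed.

Lemma cell_refl T y : y \in cell T y.
Proof. by rewrite in_cell; apply/agreeP. Qed.

Lemma mem_stage T (xT : context d T) y : y \in stage xT -> stage xT = cell T y.
Proof. by rewrite inE /cell => /eqP ->. Qed.

(** If [k] were in [T'] but not in [T], changing coordinate [k] of [y], possible since [1 < d k],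
    would stay in the first cell but leave the second. *)
Lemma cell_sub T T' y y' : cell T y \subset cell T' y' -> T' \subset T.
Proof.
move=> sub; apply/subsetP => k kT'; apply/negPn/negP => kT.
have [a neq_a] : exists a : 'I_(d k), a != y k.
  apply/existsP; rewrite -negb_forall; apply/negP => /forallP E.
  have := d_gt1 k.
  have : (#|'I_(d k)| <= 1)%N.
    by apply/fintype_le1P => a b; rewrite (eqP (E a)) (eqP (E b)).
  by rewrite card_ord leqNgt => /negP.
have /(subsetP sub) : update y a \in cell T y.
  rewrite in_cell; apply/agreeP => j jT; apply: update_neq.
  by apply: contraNneq kT => ->.
have := subsetP sub y (cell_refl T y); rewrite !in_cell.
move=> /agreeP/(_ k kT') Ey /agreeP/(_ k kT'); rewrite update_id -Ey => Ea.
by rewrite Ea eqxx in neq_a.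
Qed.

Lemma cell_inj T T' y y' : cell T y = cell T' y' -> T = T'.
Proof.
move=> E; apply/eqP; rewrite eqEsubset.
by rewrite (@cell_sub T' T y' y) ?(@cell_sub T T' y y') // E.
Qed.

(** * Bijection between stagings and context maps *)

Definition coherent s :=
  [forall y, forall z, agree (s y) y z ==> (s z == s y)].

Definition context_maps : {set {ffun level d -> {set 'I_i}}} :=
  [set s | coherent s && [forall y, #|s y| <= 2]%N].

Definition blocks s : {set {set level d}} :=
  [set cell (s y) y | y : level d].

Lemma context_mapsP s :
  reflect ((forall y z, agree (s y) y z -> s z = s y) /\
           forall y, (#|s y| <= 2)%N)
          (s \in context_maps).
Proof.
rewrite inE; apply: (iffP andP) => -[C L]; split.
- by move=> y z /(implyP (forallP (forallP C y) z)) /eqP.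
- exact/forallP.
- by apply/forallP => y; apply/forallP => z; apply/implyP => /C ->.
- exact/forallP.
Qed.

(** The block of [s] through [y] is also a cell of [s'] through some [z], with the same context set
    by [cell_inj]; it contains [y], so coherence of [s'] gives [s' y = s' z]. *)
Lemma blocks_inj : {in context_maps &, injective blocks}.
Proof.
move=> s s' _ /context_mapsP[C' _] E; apply/ffunP => y.
have /imsetP[z _ Ez] : cell (s y) y \in blocks s' by rewrite -E; apply: imset_f.
rewrite (cell_inj Ez) (C' z y) // -in_cell -Ez.
exact: cell_refl.
Qed.

Lemma blocks_staging s : s \in context_maps ->
  staging (blocks s) && max_context_vars 2 (blocks s).
Proof.
move=> /context_mapsP[C L].
have blockE y z : z \in cell (s y) y -> cell (s y) y = cell (s z) z.
  by move=> zy; rewrite [LHS](mem_stage zy) (C y z) // -in_cell.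
apply/andP; split; first apply/andP; first split.
- apply/and3P; split.
  + apply/eqP/setP => y; rewrite inE; apply/bigcupP.
    by exists (cell (s y) y); [apply: imset_f | apply: cell_refl].
  + apply/trivIsetP => _ _ /imsetP[y _ ->] /imsetP[z _ ->].
    apply: contraR => /pred0Pn[w /andP[/= wy wz]].
    by rewrite (blockE _ _ wy) (blockE _ _ wz).
  + apply/imsetP => -[y _ /setP/(_ y)].
    by rewrite inE cell_refl.
- apply/forall_inP => _ /imsetP[y _ ->].
  by apply/existsP; exists (s y); apply/existsP; exists (restr (s y) y).
(* By [cell_inj], every presentation of a block has the context set [s y], so the bound on [s y]
   applies to it. *)
- apply/forallP => T; apply/forallP => xT; apply/implyP => /imsetP[y _ E].
  have yT : y \in stage xT by rewrite E cell_refl.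
  by move: E; rewrite (mem_stage yT) => /cell_inj ->.
Qed.

Lemma staging_blocks (P : {set {set level d}}) :
  staging P -> max_context_vars 2 P -> exists2 s, s \in context_maps & P = blocks s.
Proof.
move=> /andP[/and3P[/eqP coverP trivP P0] /forall_inP stageP] maxP.
have inP y : y \in cover P by rewrite coverP inE.
have /fin_all_exists[s sP] y :
    exists T, pblock P y = cell T y /\ (#|T| <= 2)%N.
  have BP := pblock_mem (inP y).
  have /existsP[T /existsP[xT /eqP E]] := stageP _ BP.
  exists T; split; last by apply: (implyP (forallP (forallP maxP T) xT)); rewrite -E.
  by rewrite E; apply: mem_stage; rewrite -E mem_pblock.
have cellP y : cell (s y) y \in P by rewrite -(proj1 (sP y)) pblock_mem.
exists (finfun s).
  apply/context_mapsP; split=> [y z|y]; rewrite !ffunE; last exact: (proj2 (sP y)).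
  rewrite -in_cell => /(def_pblock trivP (cellP y)).
  by rewrite (proj1 (sP z)) => /cell_inj.
apply/setP => B; apply/idP/imsetP => [BP|[y _ ->]]; last by rewrite ffunE.
have [B0|[y yB]] := set_0Vmem B; first by rewrite -B0 BP in P0.
by exists y => //; rewrite ffunE -(proj1 (sP y)) (def_pblock trivP BP yB).
Qed.

Lemma card_stagings :
  #|[set P : {set {set level d}} | staging P && max_context_vars 2 P]|
  = #|context_maps|.
Proof.
rewrite -(card_in_imset blocks_inj); apply: eq_card => P; rewrite inE.
apply/andP/imsetP => [[sP mP]|[s sC ->]].
  by have [s sC ->] := staging_blocks sP mP; exists s.
exact/andP/blocks_staging.
Qed.

(** The glued point agrees with [y] on [s y] and with [z] on [s z], so by coherence its context set
    equals both. *)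
Lemma context_maps_eq s y z : s \in context_maps ->
  {in s y :&: s z, forall k, y k = z k} -> s y = s z.
Proof.
move=> /context_mapsP[C _] E.
rewrite -(C y (glue (s y) y z)) ?(C z (glue (s y) y z)) //.
  apply/agreeP => k kz; rewrite ffunE; case: ifP => // ky.
  by apply: E; rewrite inE ky.
by apply/agreeP => k ky; rewrite ffunE ky.
Qed.

(** * Existence of a context variable common to all blocks *)

Definition core s : {set 'I_i} :=
  [set k | [forall y, k \in s y]].

Definition constant_map T : {ffun level d -> {set 'I_i}} := [ffun=> T].

Definition slice_map k (g : {ffun 'I_(d k) -> 'I_i}) :
  {ffun level d -> {set 'I_i}} := [ffun y : level d => [set k; g (y k)]].

Lemma coreP s k : reflect (forall y, k \in s y) (k \in core s).
Proof. by rewrite inE; apply: forallP. Qed.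

Definition base_point : level d := [ffun k => Ordinal (ltnW (d_gt1 k))].

Lemma constant_map_inj : injective constant_map.
Proof. by move=> T T' /ffunP/(_ base_point); rewrite !ffunE. Qed.

Lemma constant_map_context T : (#|T| <= 2)%N -> constant_map T \in context_maps.
Proof. by move=> leT; apply/context_mapsP; split=> [y z|y]; rewrite !ffunE. Qed.

Lemma core_constant_map T : core (constant_map T) = T.
Proof.
apply/setP => k; apply/coreP/idP => [/(_ base_point)|kT y]; by rewrite ffunE.
Qed.

Lemma core_nonempty s : s \in context_maps ->
  s != constant_map set0 -> core s != set0.
Proof.
move=> sC s0; apply/negP => /eqP core0.
have /context_mapsP[_ L] := sC.
have nonempty y : s y != set0.
  apply: contraNneq s0 => sy0; apply/eqP/ffunP => z; rewrite ffunE -sy0.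
  by apply/esym/context_maps_eq => // k; rewrite sy0 set0I inE.
have avoid k : exists y, k \notin s y.
  by apply/existsP; rewrite -negb_forall; have := in_set0 k; rewrite -core0 inE => ->.
(* Disjoint context sets would be equal, as [context_maps_eq] applies vacuously, hence empty. *)
have meet y z : exists2 k, k \in s y & k \in s z.
  have [E|[k]] := set_0Vmem (s y :&: s z); last by rewrite inE => /andP[]; exists k.
  have Eyz : s y = s z by apply: context_maps_eq => // k; rewrite E inE.
  by have := nonempty y; rewrite -[s y]setIid [X in _ :&: X]Eyz E eqxx.
(* Since [z] avoids [a] and [w] avoids [b], pairwise intersection forces the triangle: context sets
   {a, b} at [base_point], {b, c} at [z] and {a, c} at [w]. *)
have /set0Pn[a ay] := nonempty base_point.
have [b Ey] := set_le2P ay (L _).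
have [z az] := avoid a.
have bz : b \in s z.
  by have [k] := meet base_point z; rewrite Ey !inE => /orP[]/eqP -> // /(negP az).
have [c Ez] := set_le2P bz (L _).
have [w bw] := avoid b.
have aw : a \in s w.
  by have [k] := meet base_point w; rewrite Ey !inE => /orP[]/eqP -> // /(negP bw).
have cw : c \in s w.
  by have [k] := meet z w; rewrite Ez !inE => /orP[]/eqP -> // /(negP bw).
have neq_ab : a != b by apply: contraNneq az => ->.
have neq_cb : c != b by apply: contraNneq bw => <-.
have neq_ac : a != c by apply: contraNneq az => ->; rewrite Ez !inE eqxx orbT.
have Ew : s w = [set a; c].
  apply/esym/eqP; rewrite eqEcard subUset !sub1set aw cw /= cards2 neq_ac.
  exact: L.
(* A set [s u] missing one of [a], [b], [c] would equal a context set containing it. *)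
pose u := glue [set a] base_point (glue [set b] z w).
have au : u a = base_point a by rewrite ffunE inE eqxx.
have bu : u b = z b by rewrite !ffunE !inE eq_sym (negPf neq_ab) eqxx.
have cu : u c = w c by rewrite !ffunE !inE eq_sym (negPf neq_ac) (negPf neq_cb).
have forced v k l : s v = [set k; l] -> u k = v k -> l \in s u.
  move=> Ev Euv; apply: contraT => lu.
  suff Euv' : s u = s v by rewrite Euv' Ev !inE eqxx orbT in lu.
  apply: context_maps_eq => // m; rewrite Ev in_setI in_set2.
  move=> /andP[mu /orP[]/eqP Em]; first by rewrite Em.
  by rewrite -Em mu in lu.
have su_b := forced _ _ _ Ey au.
have su_c := forced _ _ _ Ez bu.
have su_a : a \in s u by apply: forced cu; rewrite Ew setUC.
have : a |: [set b; c] \subset s u by rewrite !subUset !sub1set su_a su_b su_c.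
move=> /subset_leq_card; rewrite cardsU1 cards2 !inE negb_or neq_ab neq_ac.
by rewrite eq_sym neq_cb => /leq_trans/(_ (L u)).
Qed.

(** * Maps with a given common variable, and their number *)

Lemma slice_map_inj k : injective (@slice_map k).
Proof.
move=> g h /ffunP E; apply/ffunP => a.
by have := E (update base_point a); rewrite !ffunE !dfwith_in => /set2_injr.
Qed.

Lemma slice_map_context k (g : {ffun 'I_(d k) -> 'I_i}) :
  slice_map g \in context_maps.
Proof.
apply/context_mapsP; split=> [y z|y]; rewrite !ffunE; last first.
  by rewrite cards2; case: eqP.
by move=> /agreeP ->; rewrite // !inE eqxx.
Qed.

(** The value [g a] is read off at one point of the slice where coordinate [k] is [a]. Another
    context set in that slice, if different, would meet this one only in [k], where the points
    agree, contradicting [context_maps_eq]. *)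
Lemma slice_mapP s k : s \in context_maps -> k \in core s ->
  exists g : {ffun 'I_(d k) -> 'I_i}, s = slice_map g.
Proof.
move=> sC /coreP ks; have /context_mapsP[_ L] := sC.
have /fin_all_exists[g Eg] (a : 'I_(d k)) :
    exists j, s (update base_point a) = [set k; j].
  exact: set_le2P.
exists (finfun g); apply/ffunP => y; rewrite !ffunE -Eg.
have [j Ej] := set_le2P (ks y) (L y).
have [//|neq] := eqVneq (s y) (s (update base_point (y k))).
apply: context_maps_eq => // l; rewrite Ej Eg !inE.
have neq_j : j != g (y k) by apply: contraNneq neq => E; rewrite Ej Eg E.
have [-> _|lk /=] := eqVneq l k; first by rewrite update_id.
by move=> /andP[/eqP -> /eqP E]; rewrite E eqxx in neq_j.
Qed.

Lemma card_core_eq k : #|[set s in context_maps | k \in core s]| = (i ^ d k)%N.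
Proof.
rewrite -[in RHS](card_ord i) -[in RHS](card_ord (d k)) -card_ffun -cardsT.
rewrite -(card_imset _ (@slice_map_inj k)); apply: eq_card => s; rewrite inE.
apply/andP/imsetP => [[sC /(slice_mapP sC)[g ->]]|[g _ ->]]; first by exists g.
split; first exact: slice_map_context.
by apply/coreP => y; rewrite ffunE !inE eqxx.
Qed.

(** * Double counting of pairs of a map and a common variable *)

Definition pair_maps : {set {ffun level d -> {set 'I_i}}} :=
  [set constant_map T | T in [set T : {set 'I_i} | #|T| == 2]].

Lemma card_pair_maps : #|pair_maps| = 'C(i, 2).
Proof. by rewrite card_imset ?card_draws ?card_ord //; exact: constant_map_inj. Qed.

Lemma pair_maps_sub : pair_maps \subset context_maps.
Proof.
apply/subsetP => _ /imsetP[T T2 ->]; apply: constant_map_context.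
by rewrite inE in T2; rewrite (eqP T2).
Qed.

(** The core has size 0 for the trivial staging, 2 for a constant pair and 1 otherwise; the additive
    form avoids truncated subtraction. *)
Lemma card_core s : s \in context_maps ->
  (#|core s| + (s == constant_map set0) = 1 + (s \in pair_maps))%N.
Proof.
move=> sC; have /context_mapsP[_ L] := sC.
have core_sub y : core s \subset s y by apply/subsetP => k /coreP.
have pairE : (s \in pair_maps) = (#|core s| == 2).
  apply/imsetP/eqP => [[T T2 ->]|core2].
    by rewrite inE in T2; rewrite core_constant_map (eqP T2).
  exists (core s); first by rewrite inE core2.
  (* Each [s y] contains the two-element core and has size at most 2, so it equals the core. *)
  apply/ffunP => y; rewrite ffunE; apply/esym/eqP.
  by rewrite eqEcard core_sub core2 L.
rewrite pairE; have [->|s0] := eqVneq s (constant_map set0).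
  by rewrite core_constant_map cards0.
have := core_nonempty sC s0; rewrite -card_gt0.
have := leq_trans (subset_leq_card (core_sub base_point)) (L _).
by case: #|core s| => [|[|[|]]].
Qed.

Lemma card_context_maps :
  (#|context_maps| + 'C(i, 2) = 1 + \sum_(k < i) i ^ d k)%N.
Proof.
have sum_core : (\sum_(s in context_maps) #|core s| = \sum_(k < i) i ^ d k)%N.
  under [RHS]eq_bigr do rewrite -card_core_eq -sum1dep_card.
  (* Both sides count the pairs (s, k) with [k] in [core s]. *)
  rewrite (exchange_big_dep (mem context_maps)) /= => [|k s _ /andP[] //].
  by apply: eq_bigr => s sC; rewrite -sum1_card; apply: eq_bigl => k; rewrite sC.
have sum_triv : (\sum_(s in context_maps) (s == constant_map set0) = 1)%N.
  rewrite (bigD1 (constant_map set0)) ?constant_map_context ?cards0 //= eqxx.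
  by rewrite big1 // => s /andP[_ /negPf ->].
have sum_pair : (\sum_(s in context_maps) (s \in pair_maps) = 'C(i, 2))%N.
  rewrite -card_pair_maps -(setIidPr pair_maps_sub) -sum1_card big_mkcond /=.
  rewrite [RHS]big_mkcond; apply: eq_bigr => s _.
  by rewrite in_setI; case: (s \in context_maps); case: (s \in pair_maps).
rewrite -sum_pair -sum_core -{1}sum_triv -sum1_card -!big_split /=.
by apply: eq_bigr => s /card_core <-; rewrite addnC.
Qed.

End ContextMaps.

Theorem theorem1 (i : nat) (d : 'I_i -> nat)
    (i_ge1 : (1 <= i)%N) (d_gt1 : forall k : 'I_i, (1 < d k)%N) :
  (#|[set P : {set {set level d}} | staging P && max_context_vars 2 P]|)%:Z
  = 1 - ('C(i, 2))%:Z + \sum_(k < i) (i ^ d k)%N%:Z.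
Proof.
rewrite card_stagings // -(big_morph Posz PoszD (erefl _)).
have /(congr1 Posz) := card_context_maps d_gt1; rewrite !PoszD => E.
by rewrite addrAC -E addrK.
Qed.
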